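(* Let $(X,d)$ be a metric space and let $T, f : X \rightarrow X$ be weakly compatible selfmaps. If $T$ is weakly contractive with respect to $f$ such that $T(X)\subseteq f(X)$ and $f(X)$ is a complete subspace of $X$, then $f$ and $T$ have a unique common fixed point in $X$.
   Context: $R_{+}=[0,\infty)$. $\Phi$ denotes the set of all continuous functions $\varphi:R_{+}\rightarrow R_{+}$ with $\varphi(0)=0$ and $\varphi(t)>0$ for $t>0$. A selfmap $T:X\rightarrow X$ is weakly contractive with respect to a selfmap $f:X\rightarrow X$ if there exists a $\varphi\in\Phi$ such that for all $x,y\in X$, $d(Tx,Ty)\leq d(fx,fy)-\varphi(d(fx,fy))$. The pair $(f,T)$ is weakly compatible if $Tfx=fTx$ whenever $fx=Tx$, $x\in X$. A common fixed point of $f$ and $T$ is a point $z\in X$ with $fz=Tz=z$. *)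

(* Defs.v *)
From HB Require Import structures.
From mathcomp Require Import all_boot all_order all_algebra.
From mathcomp Require Import all_classical all_reals.
From mathcomp Require Import topology normedtype.

Set Implicit Arguments.
Unset Strict Implicit.
Unset Printing Implicit Defensive.

Import Order.TTheory GRing.Theory Num.Theory.
Import numFieldNormedType.Exports.

Local Open Scope classical_set_scope.
Local Open Scope ring_scope.

(* A map phi : R_+ -> R_+ is encoded by a total function R -> R of which only
   the values on `[0, +oo[ are constrained. *)
Definition Phi (R : realType) : set (R -> R) :=
  [set phi : R -> R | [/\ {within `[0, +oo[%classic, continuous phi},
                 forall t : R, 0 <= t -> 0 <= phi t,
                 phi 0 = 0 &
                 forall t : R, 0 < t -> 0 < phi t]].

Definition weakly_contractive (R : realType) (X : metricType R)
    (T f : X -> X) : Prop :=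
  exists2 phi, Phi phi &
    forall x y, mdist (T x) (T y) <=
      mdist (f x) (f y) - phi (mdist (f x) (f y)).

Definition weakly_compatible (X : Type) (f T : X -> X) : Prop :=
  forall x, f x = T x -> T (f x) = f (T x).

Definition complete_subspace (R : realType) (X : metricType R)
    (A : set X) : Prop :=
  forall u : nat -> X, (forall n, A (u n)) -> cauchy (u @ \oo) ->
    exists2 l, A l & u @ \oo --> l.

Definition common_fixed_point (X : Type) (f T : X -> X) (z : X) : Prop :=
  f z = z /\ T z = z.

(* Main.v *)
Require Import Defs.
From mathcomp Require Import all_boot all_order all_algebra.
From mathcomp Require Import all_classical all_reals.
From mathcomp Require Import topology normedtype.
From mathcomp Require Import lra.

Local Open Scope classical_set_scope.

(** Weak contractivity enters only through a uniform consequence of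
Meir-Keeler type: for each [e > 0] there is [d > 0] such that
[d(fx, fy) < e + d] forces [d(Tx, Ty) < e].  Indeed [t - phi t] is at most [t],
which handles [t < e], and by continuity of [phi] at [e] it stays below [e] for
[t] slightly above [e].

Since [T X] is contained in [f X], there are points [x n] with
[f (x n.+1) = T (x n)], and the condition turns into a statement about the
sequence [u n = f (x n)] alone.  It makes [u] a Cauchy sequence
([meir_keeler_cauchy]): the infimum of the distances between consecutive terms
cannot be positive, and as soon as one such distance is below [d], all later
terms stay within [e + d] of that place.  By completeness [u] tends to some
[f a].  As [T] does not increase distances measured through [f], [u] also tends
to [T a], so [f a = T a].

Finally, any two coincidence points [a], [b] have [f a = f b], because a
positive distance [e = d(fa, fb)] would give [e = d(Ta, Tb) < e].  Weak
compatibility makes [f a] another coincidence point, so [f (f a) = f a], and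
[f a] is a common fixed point; it is the only one since common fixed points are
coincidence points. *)

Section MeirKeeler.

Import Order.TTheory GRing.Theory Num.Theory.
Import numFieldNormedType.Exports.
Local Open Scope ring_scope.

Context {R : realType} {X : metricType R}.
Implicit Types (T f : X -> X) (u : nat -> X).

Definition meir_keeler T f : Prop :=
  forall e : R, 0 < e -> exists2 d : R, 0 < d &
    forall x y, mdist (f x) (f y) < e + d -> mdist (T x) (T y) < e.

Lemma weakly_contractive_meir_keeler T f :
  weakly_contractive T f -> meir_keeler T f.
Proof.
move=> [phi [phi_cont phi_ge0 _ phi_gt0] Tf] e e0.
have phie : 0 < phi e / 2 by rewrite divr_gt0 ?phi_gt0.
have e_in : `[0, +oo[%classic e by rewrite /= in_itv /= ltW.
have /subspace_continuousP/(_ e e_in) := phi_cont.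
move=> /cvgrPdist_lt/(_ _ phie); rewrite near_withinE.
move=> /nbhs_ballP[r /= r0 phi_near].
(* For e <= t < e + d one needs t - phi t < e, which holds as soon as
   t - e < phi e / 2 < phi t. *)
exists (Num.min r (phi e / 2)); first by rewrite lt_min r0.
move=> x y; set t := mdist (f x) (f y) => t_lt.
have t0 : 0 <= t by exact: mdist_ge0.
apply: le_lt_trans (Tf x y) _; rewrite -/t.
have phit := phi_ge0 _ t0.
have [te|et] := ltP t e; first by lra.
have [tr tphi] : t < e + r /\ t < e + phi e / 2.
  by move: t_lt; rewrite -ltrBlDl lt_min !ltrBlDl => /andP.
have ball_t : ball e r t.
  by rewrite /ball /= distrC ger0_norm ?subr_ge0// ltrBlDl.
have t_in : `[0, +oo[%classic t by rewrite /= in_itv /= t0.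
have /ltr_normlP[_] := phi_near t ball_t t_in.
by rewrite /from_subspace; lra.
Qed.

Lemma meir_keeler_le T f : meir_keeler T f ->
  forall x y, mdist (T x) (T y) <= mdist (f x) (f y).
Proof.
move=> mk x y; rewrite leNgt; apply/negP => fT.
have [d d0 Td] := mk _ (le_lt_trans (mdist_ge0 _ _) fT).
by have := Td x y ltac:(lra); rewrite ltxx.
Qed.

Lemma meir_keeler_coincidence_value T f a b : meir_keeler T f ->
  f a = T a -> f b = T b -> f a = f b.
Proof.
move=> mk fa fb; apply/eqP; rewrite -[_ == _]negbK -mdist_gt0; apply/negP => ab.
have [d d0 Td] := mk _ ab.
by have := Td a b ltac:(lra); rewrite -fa -fb ltxx.
Qed.

Section MeirKeelerSequence.

Context (u : nat -> X).
Hypothesis u_mk : forall e : R, 0 < e -> exists2 d : R, 0 < d &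
  forall m n, mdist (u m) (u n) < e + d -> mdist (u m.+1) (u n.+1) < e.

(** The infimum of the consecutive distances is zero: if it were [r > 0], a
distance close enough to [r] would be followed by one below [r]. *)
Lemma meir_keeler_small_gap (e : R) :
  0 < e -> exists n, mdist (u n) (u n.+1) < e.
Proof.
move=> e0; pose gaps := range (fun n => mdist (u n) (u n.+1)).
have gaps_lb : has_lbound gaps by exists 0 => _ [n _ <-]; exact: mdist_ge0.
have gaps_inf : has_inf gaps by split => //; exists (mdist (u 0%N) (u 1%N)), 0%N.
have [inf_gt0|inf_le0] := ltP 0 (inf gaps).
  have [d d0 gap_next] := u_mk _ inf_gt0.
  have [_ [n _ <-] /gap_next] := inf_adherent d0 gaps_inf.
  by rewrite ltNge ge_inf//; exists n.+1.
have [_ [n _ <-] gap_lt] := inf_adherent e0 gaps_inf.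
by exists n; lra.
Qed.

(** Near a small gap, the condition turns a radius [e / 2 + d'] into
[e / 2] after one shift, and the gap restores the lost [d']: the sequence cannot
leave that radius. *)
Lemma meir_keeler_trap (e : R) : 0 < e ->
  exists N, forall k, mdist (u N) (u (N + k)%N) < e.
Proof.
move=> e0; have e2 : 0 < e / 2 by rewrite divr_gt0.
have [d d0 u_next] := u_mk _ e2.
pose d' := Num.min d (e / 2).
have d'0 : 0 < d' by rewrite lt_min d0.
have [d'd d'e] : d' <= d /\ d' <= e / 2 by rewrite !ge_min !lexx orbT.
have [N gapN] := meir_keeler_small_gap _ d'0.
exists N => k; suff : mdist (u N) (u (N + k)%N) < e / 2 + d' by lra.
elim: k => [|k IHk]; first by rewrite addn0 mdistxx; lra.
(* From u N, step to u N.+1, which costs less than d'; from there the distance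
   to u (N + k).+1 is below e / 2 by the induction hypothesis. *)
rewrite addnS; apply: (le_lt_trans (metric_triangle _ (u N.+1) _)).
have := u_next N (N + k)%N; lra.
Qed.

Lemma meir_keeler_cauchy : cauchy (u @ \oo).
Proof.
apply: cauchy_exP => e e0; have [N uN] := meir_keeler_trap _ e0.
exists (u N); exists N => // n /= Nn.
by rewrite ballEmdist /= -(subnKC Nn).
Qed.

End MeirKeelerSequence.

Lemma meir_keeler_coincidence T f : [set: X] !=set0 -> meir_keeler T f ->
  range T `<=` range f -> complete_subspace (range f) ->
  exists a, f a = T a.
Proof.
move=> [x0 _] mk Tf f_complete.
have /choice[next next_spec] x : exists y, f y = T x.
  by have [|y _ fy] := Tf (T x); [exists x | exists y].
pose x n := iter n next x0; pose u n := f (x n).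
have uS n : u n.+1 = T (x n) by rewrite /u /x iterS next_spec.
have u_mk (e : R) : 0 < e -> exists2 d : R, 0 < d &
    forall m n, mdist (u m) (u n) < e + d -> mdist (u m.+1) (u n.+1) < e.
  move=> /mk[d d0 Td]; exists d => // m n; rewrite !uS; exact: Td.
have [|_ [a _ <-] u_fa] := f_complete u _ (meir_keeler_cauchy _ u_mk).
  by move=> n; exists (x n).
exists a; apply: (cvg_unique (@metric_hausdorff _ X) u_fa).
apply/metricType_numDomainType.cvgrPdist_lt => e e0.
have [N _ u_near] := metricType_numDomainType.cvgr_dist_lt u_fa e0.
exists N.+1 => // -[//|n] /= Nn; rewrite uS.
by apply: le_lt_trans (u_near n Nn); exact: meir_keeler_le.
Qed.

End MeirKeeler.

Theorem theorem2p1 (R : realType) (X : metricType R) (T f : X -> X)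
    (X_nonempty : [set: X] !=set0)
    (fT_compat : weakly_compatible f T)
    (T_contr : weakly_contractive T f)
    (T_sub_f : range T `<=` range f)
    (f_complete : complete_subspace (range f)) :
  exists! z : X, common_fixed_point f T z.
Proof.
have mk := weakly_contractive_meir_keeler _ _ T_contr.
have [a fa] := meir_keeler_coincidence _ _ X_nonempty mk T_sub_f f_complete.
have ffa : f (f a) = T (f a) by rewrite fT_compat// -fa.
have fix_fa : f (f a) = f a := meir_keeler_coincidence_value _ _ _ _ mk ffa fa.
exists (f a); split; first by split; rewrite -?ffa.
move=> z [fz Tz]; rewrite -[RHS]fz.
by apply: meir_keeler_coincidence_value mk fa _; rewrite fz Tz.
Qed.
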